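(* Let $n\ge 1$ be an integer, let $K\subset\mathbb{C}$ be a compact set and let $w:K\to[0,\infty)$ be a bounded upper semi-continuous function that is nonzero on at least $n+1$ points of $K$. Let $P_n$ be a monic polynomial of degree $n$ with complex coefficients, and let $K_0$ be the (compact, nonempty) set of $w$-extremal points of $P_n$ on $K$. Then $P_n$ is a weighted Chebyshev polynomial of degree $n$ on $K$ with respect to $w$ if and only if for each $q\in\mathbb{P}_{n-1}$, $$\max_{z_0\in K_0}\operatorname{Re}\bigl[P_n(z_0)\overline{q(z_0)}\,\bigr]\ge0.$$
   Context: $\mathbb{P}_{n-1}$ is the space of polynomials with complex coefficients of degree at most $n-1$. $\|P\|_{K,w}=\sup_{z\in K}w(z)|P(z)|$. A weighted Chebyshev polynomial of degree $n$ on $K$ with respect to $w$ is a monic polynomial of degree $n$ that minimizes $\|\cdot\|_{K,w}$ among all monic polynomials of degree $n$. A point $z\in K$ is a $w$-extremal point of $P$ on $K$ if $w(z)|P(z)|=\|P\|_{K,w}$. A function $w:K\to[0,\infty)$ is upper semi-continuous if $w(z)\ge\limsup_{K\ni\zeta\to z}w(\zeta)$ for each accumulation point $z$ of $K$. *)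

(* Defs.v *)
From HB Require Import structures.
From mathcomp Require Import all_boot all_order all_algebra.
From mathcomp Require Import all_classical all_reals all_analysis.
From mathcomp Require Import complex.

Set Implicit Arguments.
Unset Strict Implicit.
Unset Printing Implicit Defensive.

Import Order.TTheory GRing.Theory Num.Theory.
Import numFieldNormedType.Exports.

Local Open Scope classical_set_scope.
Local Open Scope ring_scope.

(* Sealing [R[i]] as a [numClosedFieldType] is what gives it a topology: the
   instances of [numFieldNormedType] are attached to the numeric structure (the
   norm topology of [`|x| = (normc x)%:C]), not to the record [complex]. *)
Definition Cx (R : realType) : numClosedFieldType := R[i].

Section WeightedChebyshev.
Variable R : realType.
Local Notation C := (Cx R).

(* A weight [K -> [0, oo)] is encoded as a total function [C -> R] of which only
   the values on [K] are used; the filter [within K z^'] is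
   "zeta in K, zeta -> z, zeta <> z". *)
Definition upper_semicontinuous_on (K : set C) (w : C -> R) : Prop :=
  forall z : C, K z -> limit_point K z ->
    (limf_esup (EFin \o w) (within K z^') <= (w z)%:E)%E.

(* Meaningful only when [K] is nonempty and [w * |P|] is bounded on [K], since
   the real-valued [sup] takes a default value otherwise. *)
Definition wnorm (K : set C) (w : C -> R) (P : {poly C}) : R :=
  sup [set w z * ComplexField.Normc.normc P.[z] | z in K].

Definition monic_of_degree (n : nat) (P : {poly C}) : Prop :=
  P \is monic /\ size P = n.+1.

Definition weighted_Chebyshev (n : nat) (K : set C) (w : C -> R)
    (P : {poly C}) : Prop :=
  monic_of_degree n P /\
  forall Q : {poly C}, monic_of_degree n Q -> wnorm K w P <= wnorm K w Q.

Definition extremal_points (K : set C) (w : C -> R) (P : {poly C}) : set C :=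
  [set z | K z /\ w z * ComplexField.Normc.normc P.[z] = wnorm K w P].

(* An attained maximum, unlike [sup]. *)
Definition is_maximum (S : set R) (m : R) : Prop := S m /\ ubound S m.

End WeightedChebyshev.

(* Main.v *)
(** Both directions rest on
    |P + q|^2 = |P|^2 + 2 Re(P conj q) + |q|^2.  If Q is monic of degree n,
    the criterion for q = Q - P provides an extremal point z0 of P at which
    Re(P conj q) >= 0, so |Q| >= |P| there and the norm of Q is at least that
    of P.  Conversely, if Re(P conj q) <= m < 0 on the extremal set, then
    P + e q has smaller norm than P for small e > 0: where
    Re(P conj q) < m / 2 the identity makes |P + e q| < |P|, while on the
    compact rest of K the upper semi-continuous function w |P| stays bounded
    away from the norm of P, so a perturbation of size O(e) is harmless. *)

Require Import Defs.
From mathcomp Require Import all_boot all_order all_algebra.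
From mathcomp Require Import all_classical all_reals all_analysis.
From mathcomp Require Import complex.
From mathcomp Require Import ring lra.
Import Order.TTheory GRing.Theory Num.Theory.
Import numFieldNormedType.Exports.
Local Open Scope classical_set_scope.
Local Open Scope ring_scope.

Local Notation normc := ComplexField.Normc.normc.

(** * Upper semi-continuous functions on a set *)

(* For a real-valued [f], unlike for [limf_esup], isolated points of [K] need
   no separate treatment: the neighbourhoods of [z] are not punctured. *)
Definition usc_on {T : topologicalType} {R : realType} (K : set T)
    (f : T -> R) : Prop :=
  forall z, K z -> forall a, f z < a -> \forall y \near z, K y -> f y < a.

(** At a limit point, an upper limit below [a] means that the supremum over some punctured
    neighbourhood in [K] is below [a]. A point of [K] that is not a limit point has a neighbourhood
    containing no other point of [K]. *)
Lemma upper_semicontinuous_on_usc {R : realType} {K : set (Cx R)}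
    {w : Cx R -> R} : upper_semicontinuous_on K w -> usc_on K w.
Proof.
move=> wK z Kz a wza.
have [zlim|] := pselect (limit_point K z).
  have /ereal_inf_lt[_ [V VF <-] Va] :
      (limf_esup (EFin \o w) (within K z^') < a%:E)%E.
    by apply: le_lt_trans (wK z Kz zlim) _; rewrite lte_fin.
  move: VF; rewrite /within/= /dnbhs /within/= => VF.
  near=> y => Ky; have [->//|yz] := eqVneq y z.
  rewrite -lte_fin; apply: le_lt_trans Va; apply: ereal_sup_ubound.
  exists y => //; move: yz Ky; near: y; exact: VF.
move=> /existsNP[U] /not_implyP[Uz Unone].
apply: filterS Uz => y Uy Ky; have [->//|yz] := eqVneq y z.
by case: Unone; exists y.
Unshelve. all: by end_near. Qed.

Lemma usc_onS {T : topologicalType} {R : realType} {K L : set T}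
    {f : T -> R} : L `<=` K -> usc_on K f -> usc_on L f.
Proof.
move=> LK fK z Lz a fza; apply: filterS (fK z (LK _ Lz) a fza) => y + Ly.
by apply; exact: LK.
Qed.

Lemma usc_onM {T : topologicalType} {R : realType} {K : set T}
    {w g : T -> R} :
  (forall z, K z -> 0 <= w z) -> usc_on K w ->
  (forall z, 0 <= g z) -> continuous g -> usc_on K (fun z => w z * g z).
Proof.
move=> w0 wK g0 gc z Kz a wga.
have wz0 := w0 z Kz; have gz0 := g0 z.
pose s := w z + g z + 1.
have s0 : 0 < s by rewrite /s; lra.
(* Since [t <= 1], [(w z + t) * (g z + t) <= w z * g z + t * s], and [t * s] fits into the gap up to
   [a]. *)
pose t := Num.min 1 ((a - w z * g z) / s).
have t0 : 0 < t by rewrite /t lt_min ltr01 divr_gt0// subr_gt0.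
have t1 : t <= 1 by rewrite /t ge_min lexx.
have ts : t * s <= a - w z * g z.
  by rewrite -ler_pdivlMr// /t ge_min lexx orbT.
have near_w : \forall y \near z, K y -> w y < w z + t by apply: wK => //; lra.
have near_g : \forall y \near z, g y < g z + t.
  by apply: (cvgr_lt _ (gc z)); lra.
near=> y => Ky.
have wy : w y < w z + t by move: Ky; near: y; exact: near_w.
have gy : g y < g z + t by near: y; exact: near_g.
apply: lt_le_trans (_ : (w z + t) * (g z + t) <= _).
  by apply: ltr_pM => //; exact: w0.
have tt : t * t <= t by rewrite ger_pMr.
by move: ts; rewrite /s => ts; nra.
Unshelve. all: by end_near. Qed.

(** Compactness enters as near-covering: a bound valid near each point for parameters far enough
    along a filter is valid on all of [K] for some parameter. It is used with bounds tending to
    [+oo], then with bounds tending to the supremum from below. *)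
Lemma usc_on_max {T : topologicalType} {R : realType} {K : set T}
    {f : T -> R} : compact K -> K !=set0 -> usc_on K f ->
  exists2 z, K z & forall y, K y -> f y <= f z.
Proof.
move=> /compact_near_coveringP Kc K0 fK.
have [a Ka] : exists a, forall y, K y -> f y < a.
  have : \forall a \near +oo, K `<=` (fun y => K y -> f y < a).
    apply: Kc => z Kz.
    have fz1 : f z < f z + 1 by rewrite ltrDl.
    near=> y a => /= Ky; apply: (@lt_trans _ _ (f z + 1)).
      by move: Ky; near: y; exact: fK.
    near: a; by apply: nbhs_pinfty_gt; rewrite num_real.
  move=> /filter_ex[a aK]; exists a => y Ky; exact: aK.
have supf : has_sup (f @` K).
  split; first by case: K0 => y Ky; exists (f y), y.
  by exists a => _ [y Ky <-]; exact/ltW/Ka.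
pose M := sup (f @` K).
have fM y : K y -> f y <= M.
  by move=> Ky; apply: ub_le_sup; [case: supf|exists y].
have [[z [Kz Mz]]|noM] := pselect (exists z, K z /\ M <= f z).
  by exists z => // y Ky; exact: le_trans (fM y Ky) Mz.
(* If the supremum [M] were not attained, some [b < M] would bound all values. *)
have : \forall b \near M^'-, K `<=` (fun y => K y -> f y < b).
  apply: Kc => z Kz.
  have fzM : f z < M by rewrite ltNge; apply/negP => Mz; apply: noM; exists z.
  pose c := (f z + M) / 2.
  have fzc : f z < c by rewrite /c; lra.
  have cM : c < M by rewrite /c; lra.
  near=> y b => /= Ky; apply: (@lt_trans _ _ c).
    by move: Ky; near: y; exact: fK.
  by near: b; exact: nbhs_left_gt.
move=> bK; have [b [bM Kb]] : exists b, b < M /\ forall y, K y -> f y < b.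
  have [b [bM Kb]] := filter_ex (filterI (nbhs_left_lt M) bK).
  by exists b; split=> // y Ky; exact: Kb.
suff : M <= b by rewrite leNgt bM.
by apply: ge_sup => [|_ [y Ky <-]]; [case: supf|exact/ltW/Kb].
Unshelve. all: by end_near. Qed.

(** Serves to show that the extremal set, a superlevel set of [w |P|], is closed. *)
Lemma usc_on_closed {T : topologicalType} {R : realType} (K : set T)
    (f : T -> R) (a : R) : closed K -> usc_on K f ->
  closed [set z | K z /\ a <= f z].
Proof.
move=> Kcl fK z zcl.
have Kz : K z.
  by apply: Kcl => U Uz; have [y [[Ky _] Uy]] := zcl U Uz; exists y.
split=> //; rewrite leNgt; apply/negP => /(fK z Kz) /zcl[y [[Ky ay] fy]].
by have := fy Ky; rewrite ltNge ay.
Qed.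

(** * Modulus, real part and continuity of polynomials *)

Lemma norm_normc {R : realType} (x : Cx R) : `|x| = (normc x)%:C%C.
Proof. by []. Qed.

Lemma normc_ge0 {R : realType} (x : Cx R) : 0 <= normc x.
Proof. by case: x => a b; exact: sqrtr_ge0. Qed.

Lemma normc_sqr {R : realType} (x : Cx R) :
  normc x ^+ 2 = complex.Re x ^+ 2 + complex.Im x ^+ 2.
Proof. by case: x => a b; rewrite sqr_sqrtr// addr_ge0 ?sqr_ge0. Qed.

Lemma normcD_sqr {R : realType} (x y : Cx R) :
  normc (x + y) ^+ 2 =
    normc x ^+ 2 + complex.Re (x * y^*%C) *+ 2 + normc y ^+ 2.
Proof. by rewrite !normc_sqr; case: x y => [a b] [c d] /=; ring. Qed.

Lemma normc_dist {R : realType} (x y : Cx R) :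
  `|normc x - normc y| <= normc (x - y).
Proof.
have := ler_dist_dist x y.
rewrite !norm_normc -raddfB lecR /=.
by rewrite expr0n addr0 sqrtr_sqr.
Qed.

Lemma contraction_continuous {R : realType} (g : Cx R -> R) :
  (forall x y, `|g x - g y| <= normc (x - y)) -> continuous g.
Proof.
move=> gle x.
apply/(@cvgrPdist_lt _ _ _ (nbhs x) (nbhs_filter x)) => e e0.
(* Balls of [Cx R] have radii in [Cx R], so the real [e] is cast. *)
have xe : \forall y \near x, `|x - y| < (e%:C%C : Cx R).
  by apply: nbhsx_ballx; rewrite ltcR.
near=> y; apply: le_lt_trans (gle _ _) _.
by rewrite -ltcR -norm_normc; near: y.
Unshelve. all: by end_near. Qed.

Lemma continuous_poly {R : realType} (p : {poly Cx R}) :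
  continuous (fun z : Cx R => p.[z]).
Proof.
elim/poly_ind: p => [|p c IH].
  rewrite (_ : (fun _ => _) = cst 0); first exact: cst_continuous.
  by apply/funext => z; rewrite horner0.
rewrite (_ : (fun _ => _) = (fun z => p.[z] * z + c)); last first.
  by apply/funext => z; rewrite hornerMXaddC.
move=> z; apply: (@cvgD _ _ _ _ (nbhs_filter z));
  last exact: cst_continuous.
by apply: (@cvgM _ _ _ (nbhs_filter z));
  [exact: IH|exact: cvg_id].
Qed.

Lemma continuous_contraction_poly {R : realType} (g : Cx R -> R)
    (p : {poly Cx R}) : (forall x y, `|g x - g y| <= normc (x - y)) ->
  continuous (fun z => g p.[z]).
Proof.
move=> gle z; apply: continuous_comp; first exact: continuous_poly.
exact: contraction_continuous.
Qed.

Lemma continuous_normc_poly {R : realType} (p : {poly Cx R}) :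
  continuous (fun z => normc p.[z]).
Proof. exact/continuous_contraction_poly/normc_dist. Qed.

Lemma continuous_Re_polyM_conj {R : realType} (p q : {poly Cx R}) :
  continuous (fun z => complex.Re (p.[z] * (q.[z])^*%C)).
Proof.
(* In this form only real and imaginary parts occur, and these are 1-Lipschitz. *)
rewrite (_ : (fun _ => _) = fun z => complex.Re p.[z] * complex.Re q.[z] +
    complex.Im p.[z] * complex.Im q.[z]); last first.
  by apply/funext => z; case: p.[z] q.[z] => [a b] [c d] /=; ring.
have ReP (x y : Cx R) : `|complex.Re x - complex.Re y| <= normc (x - y).
  rewrite -ler_sqr ?nnegrE ?normc_ge0// real_normK ?num_real// normc_sqr.
  by rewrite raddfB lerDl sqr_ge0.
have ImP (x y : Cx R) : `|complex.Im x - complex.Im y| <= normc (x - y).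
  rewrite -ler_sqr ?nnegrE ?normc_ge0// real_normK ?num_real// normc_sqr.
  by rewrite [complex.Im (x - y)]raddfB lerDr sqr_ge0.
by move=> z; apply: (@cvgD _ _ _ _ (nbhs_filter z));
  apply: (@cvgM _ _ _ (nbhs_filter z)); exact: continuous_contraction_poly.
Qed.

Lemma Cx_hausdorff {R : realType} : hausdorff_space (Cx R).
Proof. exact: norm_hausdorff. Qed.

(** Ensures that the [sup] in [wnorm] is a true maximum and never its default value. *)
Lemma wnorm_attained {R : realType} {K : set (Cx R)} {w : Cx R -> R}
    (Q : {poly Cx R}) :
  compact K -> K !=set0 -> (forall z, K z -> 0 <= w z) -> usc_on K w ->
  exists z, [/\ K z, w z * normc Q.[z] = wnorm K w Q &
    forall y, K y -> w y * normc Q.[y] <= wnorm K w Q].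
Proof.
move=> Kc K0 w0 wK.
have [z Kz zmax] := usc_on_max Kc K0
  (usc_onM w0 wK (fun z => normc_ge0 Q.[z])
    (continuous_normc_poly Q)).
suff <- : w z * normc Q.[z] = wnorm K w Q by exists z.
apply/eqP; rewrite eq_le /wnorm; apply/andP; split.
  apply: ub_le_sup; last by exists z.
  by exists (w z * normc Q.[z]) => _ [y Ky <-]; exact: zmax.
by apply: ge_sup => [|_ [y Ky <-]]; [exists (w z * normc Q.[z]), z|exact: zmax].
Qed.

(** * Root counting, small factors and monic polynomials *)

(** A nonzero polynomial has fewer roots than its size, while [S] contains [n] distinct points. *)
Lemma card_le_exists_nonroot {F : numFieldType} {n : nat} {P : {poly F}}
    {S : set F} : (`I_n #<= S)%card -> P != 0 -> (size P <= n)%N ->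
  exists2 z, S z & P.[z] != 0.
Proof.
move=> /(@pcard_leP _ F)[f] P0 Pn; apply: contrapT => noz.
have froot i : (i < n)%N -> root P (f i).
  move=> ilt; apply/negP => /negP fi; apply: noz; exists (f i) => //.
  exact: funS.
have : (size (map f (iota 0 n)) < size P)%N.
  apply: max_poly_roots => //.
    apply/allP => _ /mapP[i + ->]; rewrite mem_iota add0n => /andP[_ ilt].
    exact: froot.
  rewrite map_inj_in_uniq ?iota_uniq// => i j.
  rewrite !mem_iota !add0n /= => ilt jlt; apply: (@inj _ _ _ f);
    by rewrite inE.
by rewrite size_map size_iota ltnNge Pn.
Qed.

Lemma exists_small_factor {R : realType} {a b c d : R} :
  0 <= a -> 0 < b -> 0 <= c -> 0 < d ->
  exists e, [/\ 0 < e, e * a < b & e * c < d].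
Proof.
move=> a0 b0 c0 d0.
have bound (u v : R) : 0 <= u -> 0 < v -> forall e, 0 < e ->
      e <= v / (u + 1) -> e * u < v.
  move=> u0 v0 e e0; rewrite ler_pdivlMr ?ltr_wpDl// => ev; lra.
(* The [+ 1] covers zero [a] or [c] and makes both bounds strict. *)
exists (Num.min (b / (a + 1)) (d / (c + 1))).
have e0 : 0 < Num.min (b / (a + 1)) (d / (c + 1)).
  by rewrite lt_min !divr_gt0// ltr_wpDl.
by split=> //; apply: bound => //; rewrite ge_min lexx ?orbT.
Qed.

Lemma monic_of_degreeD {R : realType} {n : nat} {P q : {poly Cx R}} :
  monic_of_degree n P -> (size q <= n)%N -> monic_of_degree n (P + q).
Proof.
move=> [Pm Ps] qn; have qP : (size q < size P)%N by rewrite Ps.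
by split; [rewrite monicE lead_coefDl// -monicE|rewrite size_polyDl].
Qed.

Lemma monic_of_degreeB {R : realType} {n : nat} {P Q : {poly Cx R}} :
  monic_of_degree n P -> monic_of_degree n Q -> (size (Q - P)%R <= n)%N.
Proof.
move=> [Pm Ps] [Qm Qs].
have le1 : (size (Q - P)%R <= n.+1)%N.
  by apply: leq_trans (size_polyD _ _) _; rewrite size_polyN Ps Qs maxnn.
apply/leq_sizeP => j; rewrite leq_eqVlt => /predU1P[<-|jn]; last first.
  by move/leq_sizeP: le1; apply.
rewrite coefB; move: Pm Qm; rewrite !monicE !lead_coefE Ps Qs /=.
by move=> /eqP-> /eqP->; rewrite subrr.
Qed.

(** * The criterion for weighted Chebyshev polynomials *)

Theorem theorem3 (R : realType) (n : nat) (n_ge1 : (1 <= n)%N)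
    (K : set (Cx R)) (K_compact : compact K)
    (w : Cx R -> R)
    (w_ge0 : forall z, K z -> 0 <= w z)
    (w_bounded : exists M : R, forall z, K z -> w z <= M)
    (w_usc : upper_semicontinuous_on K w)
    (w_neq0 : (`I_n.+1 #<= [set z | K z /\ w z != 0])%card)
    (P : {poly Cx R}) (P_monic : monic_of_degree n P) :
  let K0 := extremal_points K w P in
  [/\ compact K0, K0 !=set0 &
      weighted_Chebyshev n K w P <->
      (forall q : {poly Cx R}, (size q <= n)%N ->
         exists2 m : R,
           is_maximum [set complex.Re (P.[z0] * (q.[z0])^*%C) | z0 in K0] m &
           0 <= m)].
Proof.
move=> K0; have wK := upper_semicontinuous_on_usc w_usc.
(* [P] has at most [n] roots, so [w |P|] is positive somewhere on [K] and the norm of [P] is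
   positive. *)
have [z0 [Kz0 wz0] Pz0] : exists2 z, K z /\ w z != 0 & P.[z] != 0.
  apply: card_le_exists_nonroot w_neq0 _ _; last by case: P_monic => _ ->.
  exact: monic_neq0 P_monic.1.
have Kne : K !=set0 by exists z0.
have attained Q := wnorm_attained Q K_compact Kne w_ge0 wK.
have [z1 [Kz1 fz1 f_le]] := attained P.
have M_gt0 : 0 < wnorm K w P.
  apply: lt_le_trans (f_le _ Kz0); apply: mulr_gt0.
    by rewrite lt_neqAle eq_sym wz0 w_ge0.
  rewrite lt_neqAle normc_ge0 andbT eq_sym; apply: contra Pz0 => /eqP.
  by move=> /ComplexField.Normc.eq0_normc ->.
have K0ne : K0 !=set0 by exists z1.
have fusc : usc_on K (fun z => w z * normc P.[z]).
  apply: usc_onM => //; first by move=> z; exact: normc_ge0.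
  exact: continuous_normc_poly.
have Kcl : closed K := compact_closed (@Cx_hausdorff R) K_compact.
have K0c : compact K0.
  apply: (subclosed_compact _ K_compact); last by move=> z [].
  rewrite (_ : K0 = [set z | K z /\ wnorm K w P <= w z * normc P.[z]]).
    exact: usc_on_closed.
  apply/seteqP; split=> z [Kz fz]; split=> //; first by rewrite fz.
  by apply/eqP; rewrite eq_le fz f_le.
split=> //; split=> [[_ Pmin] q qn|crit].
  have gc := continuous_Re_polyM_conj P q.
  pose g z := complex.Re (P.[z] * (q.[z])^*%C).
  have [z2 /[!inE] K0z2 gmax] :=
    compact_EVT_max K0ne K0c (continuous_subspaceT gc).
  exists (g z2).
    split; first by exists z2.
    by move=> _ [y K0y <-]; apply: gmax; rewrite inE.
  rewrite leNgt; apply/negP => m_lt0.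
  set m := g z2 in m_lt0.
  have [zB /[!inE] KzB qmax] := compact_EVT_max Kne K_compact
    (continuous_subspaceT (continuous_normc_poly q)).
  set B := normc q.[zB] in qmax.
  have qB z : K z -> normc q.[z] <= B by move=> Kz; apply: qmax; rewrite inE.
  have B0 : 0 <= B := normc_ge0 _.
  have [W W0 wW] : exists2 W, 0 <= W & forall z, K z -> w z <= W.
    have [W wW] := w_bounded; exists W => //.
    by apply: le_trans (wW _ Kz0); exact: w_ge0.
  (* As [m < m / 2], the set [L] misses [K0]; off [L], [g] is bounded away from 0 by a negative
     constant. *)
  pose L := [set z | K z /\ m / 2 <= g z].
  have Lcl : closed L.
    apply: closedI => //; apply: (@preimage_closed _ _ g [set x | m / 2 <= x]).
      by move=> z _; exact: gc.
    exact: closed_ge.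
  have LK : L `<=` K by move=> z [].
  have Lc : compact L := subclosed_compact Lcl K_compact LK.
  have [M1 M1_lt f_leM1] : exists2 M1, M1 < wnorm K w P &
      forall z, L z -> w z * normc P.[z] <= M1.
    have [Lne|noL] := pselect (L !=set0); last first.
      (* For empty [L] any number below the norm serves; 0 does because the norm is positive. *)
      by exists 0 => // z Lz; case: noL; exists z.
    have [z3 [Kz3 gz3] z3max] :=
      usc_on_max Lc Lne (usc_onS LK fusc).
    exists (w z3 * normc P.[z3]) => //.
    (* Equality would make [z3] extremal, forcing [g z3 <= m < m / 2]. *)
    rewrite lt_neqAle f_le// andbT; apply/eqP => fz3.
    have : g z3 <= m by apply: gmax; rewrite inE.
    lra.
  (* The first bound gives [2 g + e |q|^2 < m - m = 0] off [L]; the second keeps the growth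
     [e w |q|] on [L] below the gap left by [M1]. *)
  have [e [e0 eB2 eWB]] : exists e, [/\ 0 < e, e * B ^+ 2 < - m &
      e * (W * B) < wnorm K w P - M1].
    by apply: exists_small_factor;
      rewrite ?sqr_ge0 ?mulr_ge0// ?oppr_gt0 ?subr_gt0.
  pose r := e%:C%C *: q.
  have rE z : r.[z] = e%:C%C * q.[z] by rewrite hornerZ.
  have normr_r z : normc r.[z] = e * normc q.[z].
    rewrite rE ComplexField.Normc.normcM; congr (_ * _).
    by rewrite /= expr0n /= addr0 sqrtr_sqr gtr0_norm.
  have Re_r z : complex.Re (P.[z] * (r.[z])^*%C) = e * g z.
    by rewrite rE /g; case: P.[z] q.[z] => [x y] [u v] /=; ring.
  have rn : (size r <= n)%N := leq_trans (size_scale_leq _ _) qn.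
  (* The norm of [P + r] is attained at [z4], so a strict inequality at this one point suffices. *)
  have [z4 [Kz4 fz4 _]] := attained (P + r).
  have := Pmin _ (monic_of_degreeD P_monic rn).
  rewrite -fz4 leNgt => /negP; apply; rewrite hornerD.
  have wz4 := w_ge0 _ Kz4; have qz4 := qB _ Kz4; have wW4 := wW _ Kz4.
  have qz40 := normc_ge0 q.[z4].
  have [gz4|gz4] := leP (m / 2) (g z4).
    have Lz4 : L z4 by [].
    have nD : normc (P.[z4] + r.[z4]) <= normc P.[z4] + e * normc q.[z4].
      by rewrite -normr_r; exact: le_normcD.
    apply: le_lt_trans (ler_wpM2l wz4 nD) _.
    rewrite mulrDr; have := f_leM1 _ Lz4.
    have : w z4 * normc q.[z4] <= W * B by exact: ler_pM.
    have : w z4 * (e * normc q.[z4]) = e * (w z4 * normc q.[z4]) by ring.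
    nra.
  have nlt : normc (P.[z4] + r.[z4]) < normc P.[z4].
    rewrite -ltr_sqr ?nnegrE ?normc_ge0// normcD_sqr Re_r normr_r.
    have : normc q.[z4] ^+ 2 <= B ^+ 2 by rewrite ler_sqr ?nnegrE.
    move=> q2; have : e * normc q.[z4] ^+ 2 <= e * B ^+ 2 by rewrite ler_pM2l.
    move=> eq2; have : e * (g z4 *+ 2 + e * normc q.[z4] ^+ 2) < 0.
      by rewrite pmulr_rlt0// mulr2n; lra.
    rewrite mulr2n expr2 => ?; lra.
  (* Where the weight vanishes, strictness comes from the positive norm instead of from [nlt]. *)
  have [w0|w_neq] := eqVneq (w z4) 0; first by rewrite w0 mul0r.
  apply: lt_le_trans (f_le _ Kz4); rewrite ltr_pM2l//.
  by rewrite lt_neqAle eq_sym w_neq.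
split=> // Q Q_monic.
(* The maximum is attained, so one extremal [z] realises it for [Q - P]. *)
have [_ [[z [Kz fz] <-] _] Re_ge0] :=
  crit _ (monic_of_degreeB P_monic Q_monic).
have [_ [_ _ Q_le]] := attained Q.
rewrite -fz; apply: le_trans (Q_le _ Kz).
rewrite ler_wpM2l ?w_ge0//.
rewrite -ler_sqr ?nnegrE ?normc_ge0//.
have -> : Q.[z] = P.[z] + (Q - P).[z] by rewrite hornerD hornerN addrC subrK.
by rewrite normcD_sqr -addrA lerDl addr_ge0 ?sqr_ge0 ?mulrn_wge0.
Qed.
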